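(* Let $T$ be a bounded linear operator on a separable infinite-dimensional Banach space $X$, and assume that $T$ admits an ergodic Borel probability measure with full support. Then the set of distributionally irregular vectors for $T$ is comeager in $X$. In particular this holds if $X$ is a complex Banach space and $T$ has a perfectly spanning set of unimodular eigenvectors.
   Context: A vector $x\in X$ is distributionally irregular for $T$ if there exist sets $A,B\subset\mathbb N$, both of upper density $1$ (upper density $\overline{\mathrm{dens}}(D)=\limsup_N\frac1N\#(D\cap[1,N])$), such that $\|T^ix\|\to0$ as $i\to\infty$, $i\in A$, and $\|T^ix\|\to\infty$ as $i\to\infty$, $i\in B$. A unimodular eigenvector is an eigenvector whose eigenvalue has modulus $1$. $T$ has a perfectly spanning set of unimodular eigenvectors if for every countable $D\subset\mathbb T$, $\overline{\mathrm{span}}\,[\ker(T-\lambda I):\lambda\in\mathbb T\setminus D]=X$. *)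

(* Defs.v *)
From HB Require Import structures.
From mathcomp Require Import all_boot all_order all_algebra.
From mathcomp Require Import all_classical all_reals all_analysis.
From mathcomp.real_closed Require Import complex.
Import Order.TTheory GRing.Theory Num.Theory.
Set Implicit Arguments.
Unset Strict Implicit.
Unset Printing Implicit Defensive.
Local Open Scope ring_scope.
Local Open Scope classical_set_scope.

Notation Borel T := (g_sigma_algebraType (@open T)).

Definition in_span (K : numFieldType) (X : lmodType K) (S : set X) (x : X) :=
  exists (n : nat) (v : 'I_n -> X) (c : 'I_n -> K),
    (forall i, S (v i)) /\ x = \sum_(i < n) c i *: v i.

Definition separable (T : topologicalType) :=
  exists D : set T, countable D /\ dense D.

Definition infinite_dimensional (K : numFieldType) (X : lmodType K) :=
  forall (n : nat) (v : 'I_n -> X), exists x : X, ~ in_span (range v) x.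

Definition comeager (T : topologicalType) (A : set T) :=
  exists U : nat -> set T, (forall n, open (U n) /\ dense (U n)) /\
    \bigcap_n U n `<=` A.

Definition count_upto (D : set nat) (N : nat) : nat :=
  (\sum_(1 <= i < N.+1) (if `[< D i >] then 1 else 0))%N.

Definition upper_density (R : realType) (D : set nat) : R :=
  limn_sup (fun N => (count_upto D N)%:R / N%:R : R^o).

Definition distr_irregular (R : realType) (K : numFieldType)
    (X : normedModType K) (T : X -> X) (x : X) :=
  exists A B : set nat,
    upper_density R A = 1 /\ upper_density R B = 1 /\
    (forall e : K, 0 < e -> exists N, forall i, A i -> (N <= i)%N ->
        `|iter i T x| < e) /\
    (forall M : nat, exists N, forall i, B i -> (N <= i)%N ->
        M%:R < `|iter i T x|).

Definition ergodic (R : realType) (X : ptopologicalType) (T : X -> X)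
    (mu : probability (Borel X) R) :=
  (forall A : set (Borel X), measurable A -> mu (T @^-1` A) = mu A) /\
  (forall A : set (Borel X), measurable A -> T @^-1` A = A ->
     mu A = 0%E \/ mu A = 1%E).

Definition full_support (R : realType) (X : ptopologicalType)
    (mu : probability (Borel X) R) :=
  forall U : set X, open U -> U !=set0 -> (0 < mu U)%E.

Definition perfectly_spanning_unimodular (R : realType)
    (X : normedModType R[i]) (T : X -> X) :=
  forall D : set R[i], countable D ->
    closure (in_span [set x | exists l : R[i],
        `|l| = 1 /\ ~ D l /\ T x = l *: x]) = setT.

(* Main.v *)
(** The vectors whose orbit is small (resp. large) with frequency close to [1]
    up to some late time form open sets [U k] (resp. [V k]), and every vector in
    all of them is distributionally irregular; it remains to show that these sets
    are dense.

    If [mu] is ergodic with full support, then [mu]-almost every orbit visits a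
    set [A] with upper density at least [mu A]. A large ball, and the complement
    of a small one, have measure close to [1] ([mu {0} = 0] by ergodicity), and by
    linearity a homothety turns visits to a large ball into visits to a small one,
    or visits to the complement of a small ball into visits to the complement of a
    large one.

    If the unimodular eigenvectors are perfectly spanning, no measure is built.
    Outside a countable set of eigenvalues, each eigenvector [v] is a limit of
    eigenvectors [v'] with infinitely many different eigenvalues. Averaging many
    such [v'] gives a vector close to [v] whose orbit is small at most times, and
    a large multiple of [v - v'] is a small perturbation whose orbit is large at
    most times. *)

Require Import Defs.
From HB Require Import structures.
From mathcomp Require Import all_boot all_order all_algebra.
From mathcomp Require Import all_classical all_reals all_analysis.
From mathcomp.real_closed Require Import complex.
From mathcomp Require Import measurable_realfun zify ring.
Import Order.TTheory GRing.Theory Num.Theory.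
Import numFieldNormedType.Exports.
Local Open Scope ring_scope.
Local Open Scope classical_set_scope.

(** * Frequent sets of integers and open conditions on orbits *)

(** The inequality says that the proportion of [P] in [[1, N]] is at least [1 - 1/(k+1)], cleared of
    denominators. One [k] controls both precision and lateness. *)
Definition frequent (k : nat) (P : set nat) :=
  exists2 N, (k <= N)%N & (k * N <= k.+1 * count_upto P N)%N.

Lemma count_upto0 (P : set nat) : count_upto P 0 = 0%N.
Proof. by rewrite /count_upto big_geq. Qed.

Lemma count_uptoS (P : set nat) N :
  count_upto P N.+1 = (count_upto P N + `[< P N.+1 >])%N.
Proof. by rewrite /count_upto big_nat_recr //=; case: ifP. Qed.

Lemma count_upto_le (P : set nat) N : (count_upto P N <= N)%N.
Proof.
elim: N => [|N IH]; first by rewrite count_upto0.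
by rewrite count_uptoS; case: `[< _ >]; lia.
Qed.

Lemma count_upto_mono (P Q : set nat) N :
  (forall i, (i <= N)%N -> P i -> Q i) -> (count_upto P N <= count_upto Q N)%N.
Proof.
elim: N => [|N IH] PQ; first by rewrite !count_upto0.
rewrite !count_uptoS leq_add ?IH//; first by move=> i iN; apply: PQ; lia.
by case: asboolP => // PN; rewrite (introT (asboolP _) (PQ _ _ PN)).
Qed.

Lemma count_upto_shift (P : set nat) N :
  (count_upto P N.+1 = `[< P 1%N >] + count_upto (fun i => P i.+1) N)%N.
Proof.
elim: N => [|N IH]; first by rewrite count_uptoS !count_upto0 addn0.
by rewrite count_uptoS IH count_uptoS addnA.
Qed.

Lemma count_uptoC (P : set nat) N :
  (count_upto P N + count_upto (~` P) N = N)%N.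
Proof.
elim: N => [|N IH]; first by rewrite !count_upto0.
rewrite !count_uptoS asbool_neg; case: `[< _ >] => /=; lia.
Qed.

Lemma count_uptoU (P Q : set nat) N :
  (count_upto (P `|` Q) N <= count_upto P N + count_upto Q N)%N.
Proof.
elim: N => [|N IH]; first by rewrite !count_upto0.
rewrite !count_uptoS asbool_or; do 2 case: `[< _ >] => /=; lia.
Qed.

Lemma frequent_sub k (P Q : set nat) : P `<=` Q -> frequent k P -> frequent k Q.
Proof.
move=> PQ [N kN cN]; exists N => //; apply: leq_trans cN _.
by rewrite leq_mul2l count_upto_mono ?orbT// => i _; exact: PQ.
Qed.

(* The diagonal set consists of the [i] lying in [P j] for every [j] with
   [g j < i]; on the window [1, g k] it contains [P k]. *)
Lemma frequent_diagonal (R : realType) (P : nat -> set nat) :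
  (forall k, P k.+1 `<=` P k) -> (forall k, frequent k (P k)) ->
  exists2 A : set nat, upper_density R A = 1 &
    forall k, exists N, forall i, A i -> (N <= i)%N -> P k i.
Proof.
move=> Pdecr Pfreq.
have Pmono j k : (j <= k)%N -> P k `<=` P j.
  move=> /subnK <-; elim: (k - j)%N => [//|n IH].
  by rewrite addSn; apply: subset_trans IH; exact: Pdecr.
have [f fP] : {f : nat -> nat & forall k, (k <= f k)%N /\
    (k * f k <= k.+1 * count_upto (P k) (f k))%N}.
  apply: (@choice _ _ (fun k N => (k <= N)%N /\
    (k * N <= k.+1 * count_upto (P k) N)%N)) => k.
  by have [N kN cN] := Pfreq k; exists N.
(* Calling [f] at [m = maxn k (g k')] makes [g] monotone and at least [k]; the window found there is
   good for [P m] with [m >= k], hence for [P k]. *)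
pose g := fix g k := if k is k'.+1 then f (maxn k (g k')) else f 0%N.
have gS k : (g k <= g k.+1)%N.
  by rewrite /= ; have [] := fP (maxn k.+1 (g k)); lia.
have gmono j k : (j <= k)%N -> (g j <= g k)%N.
  by move=> /subnK <-; elim: (k - j)%N => [//|n IH]; exact: leq_trans IH (gS _).
have gge k : (k <= g k)%N.
  by case: k => [//|k] /=; have [] := fP (maxn k.+1 (g k)); lia.
have gcount k : (k * g k <= k.+1 * count_upto (P k) (g k))%N.
  case: k => [//|k] /=; set m := maxn k.+1 (g k); have [_ H] := fP m.
  have km : (k.+1 <= m)%N by rewrite /m; lia.
  have cP : (count_upto (P m) (f m) <= count_upto (P k.+1) (f m))%N.
    by apply: count_upto_mono => i _; exact: Pmono.
  move: H cP (count_upto_le (P m) (f m)) km.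
  by move: (f m) => c; move: (count_upto _ _) (count_upto _ _) => a b; nia.
pose A := [set i | forall j, (g j < i)%N -> P j i].
exists A; last by move=> k; exists (g k).+1 => i Ai /Ai.
have Acount k : (k * g k <= k.+1 * count_upto A (g k))%N.
  apply: leq_trans (gcount k) _; rewrite leq_mul2l; apply/orP; right.
  apply: count_upto_mono => i ik Pki j gji; apply: (@Pmono j k) => //.
  by rewrite leqNgt; apply/negP => kj; have := gmono k j (ltnW kj); lia.
rewrite /upper_density /limn_sup.
(* Every tail of the frequencies has supremum exactly [1]. At [N = 0] the quotient is [0], since
   [0^-1 = 0]. *)
suff -> : sups (fun N => (count_upto A N)%:R / N%:R : R^o) = fun=> 1.
  by rewrite lim_cst.
apply/funext => n; rewrite /sups /=; apply/eqP; rewrite eq_le; apply/andP; split.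
  apply: ge_sup; first by eexists; exists n => /=; [exact: leqnn|reflexivity].
  move=> _ [N /= nN <-].
  case: N nN => [|N] nN; first by rewrite invr0 mulr0.
  by rewrite ler_pdivrMr ?ltr0n// mul1r ler_nat count_upto_le.
apply/ler_addgt0Pl => e e0.
(* [k > n] puts the window [g k] in the tail, and [k.+1 > e^-1] makes its frequency exceed
   [1 - e]. *)
pose k := maxn n.+1 (Num.truncn (e^-1)).
have ke : (k.+1%:R : R)^-1 < e.
  rewrite invf_plt ?posrE//; apply: lt_le_trans (truncnS_gt _) _.
  by rewrite ler_nat ltnS leq_maxr.
rewrite -lerBlDl; apply: (@le_trans _ _ ((count_upto A (g k))%:R / (g k)%:R)).
  have gk0 : (0 < g k)%N by have := gge k; rewrite /k; lia.
  rewrite ler_pdivlMr ?ltr0n//.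
  have := Acount k; rewrite -(ler_nat R) !natrM -ler_pdivrMl// => ?.
  apply: le_trans; last eassumption.
  rewrite mulrA ler_wpM2r//.
  have -> : (k.+1%:R^-1 * k%:R : R) = 1 - k.+1%:R^-1.
    by rewrite -(natr1 k); field; rewrite natr1 pnatr_eq0.
  by rewrite lerD2l lerN2 ltW.
apply: sup_ubound; last by exists (g k) => //=; have := gge k; rewrite /k; lia.
exists 1 => _ [N /= nN <-].
case: N nN => [|N] nN; first by rewrite invr0 mulr0.
by rewrite ler_pdivrMr ?ltr0n// mul1r ler_nat count_upto_le.
Qed.

(** By induction on [N]: a count of [m + 1] at time [N + 1] is either reached at time [N], or
    completed from [m] by a visit to [O N.+1]. *)
Lemma open_count_upto (X : topologicalType) (O : nat -> set X) m N :
  (forall i, open (O i)) -> open [set x | (m <= count_upto (O ^~ x) N)%N].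
Proof.
move=> oO; elim: N m => [|N IH] [|m].
- by rewrite (_ : mkset _ = setT) ?predeqE//; exact: openT.
- by rewrite (_ : mkset _ = set0) ?predeqE => [|x]; [exact: open0|rewrite /= count_upto0].
- by rewrite (_ : mkset _ = setT) ?predeqE//; exact: openT.
rewrite (_ : mkset _ = [set x | (m.+1 <= count_upto (O ^~ x) N)%N] `|`
   ([set x | (m <= count_upto (O ^~ x) N)%N] `&` O N.+1)).
  by apply: openU; [exact: IH|apply: openI; [exact: IH|exact: oO]].
apply/predeqP => x /=; rewrite count_uptoS.
case: asboolP => Ox /=; rewrite ?addn1 ?addn0 ?ltnS; split.
- by right.
- by case=> [|[]//]; exact: ltnW.
- by left.
- by case=> [|[]].
Qed.

Lemma open_frequent (X : topologicalType) (O : nat -> set X) k :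
  (forall i, open (O i)) -> open [set x | frequent k (O ^~ x)].
Proof.
move=> oO.
rewrite (_ : mkset _ = \bigcup_(N in [set N | (k <= N)%N])
    \bigcup_(m in [set m | (k * N <= k.+1 * m)%N])
      [set x | (m <= count_upto (O ^~ x) N)%N]).
  by do 2 apply: bigcup_open => ? _; exact: open_count_upto.
apply/predeqP => x; split=> [[N kN cN]|[N kN [m mN /= cm]]].
  by exists N => //; exists (count_upto (O ^~ x) N) => /=.
exists N => //; apply: (leq_trans mN); rewrite leq_mul2l; exact/orP/or_intror.
Qed.

Lemma continuous_iter (X : topologicalType) (T : X -> X) n :
  continuous T -> continuous (iter n T).
Proof.
move=> cT; elim: n => [|n IH] x; first exact: cvg_id.
by apply: (@continuous_comp _ _ _ (iter n T) T); [exact: IH|exact: cT].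
Qed.

Section orbits.
Context (K : numFieldType) (X : normedModType K).

Definition norm_lt (r : K) := [set x : X | `|x| < r].
Definition norm_gt (r : K) := [set x : X | r < `|x|].

Lemma open_norm_lt (r : K) : open (norm_lt r).
Proof.
rewrite openE => x /= xr; rewrite /interior -nbhs_ballE.
exists (r - `|x|) => /=; first by rewrite subr_gt0.
move=> y; rewrite -ball_normE /= /norm_lt /= distrC => xy.
rewrite -(subrK x y); apply: le_lt_trans (ler_normD _ _) _.
by rewrite -ltrBrDr.
Qed.

Lemma open_norm_gt (r : K) : open (norm_gt r).
Proof.
rewrite openE => x /= xr; rewrite /interior -nbhs_ballE.
exists (`|x| - r) => /=; first by rewrite subr_gt0.
move=> y; rewrite -ball_normE /= /norm_gt /= => xy.
rewrite -(ltrD2l `|x - y|); apply: (@lt_le_trans _ _ `|x|).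
  by rewrite -ltrBrDr.
by rewrite -{1}(subrK y x) ler_normD.
Qed.

(** The Archimedean hypothesis lets the bounds [1/(k+1)] handle every positive [e] of [K]; assuming
    it abstractly covers [R] and [R[i]] at once. *)
Lemma distr_irregular_comeager (R : realType) (T : X -> X) :
  (forall e : K, 0 < e -> exists n : nat, n.+1%:R^-1 < e) ->
  continuous T ->
  (forall k, dense [set x | frequent k [set i | norm_lt k.+1%:R^-1 (iter i T x)]]) ->
  (forall k, dense [set x | frequent k [set i | norm_gt k%:R (iter i T x)]]) ->
  comeager [set x : X | distr_irregular R T x].
Proof.
move=> archi cT dU dV.
have oU k : open [set x | frequent k [set i | norm_lt k.+1%:R^-1 (iter i T x)]].
  apply: (@open_frequent _ (fun i => iter i T @^-1` norm_lt k.+1%:R^-1)) => i.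
  apply: open_comp; first by move=> x _; exact: continuous_iter.
  exact: open_norm_lt.
have oV k : open [set x | frequent k [set i | norm_gt k%:R (iter i T x)]].
  apply: (@open_frequent _ (fun i => iter i T @^-1` norm_gt k%:R)) => i.
  apply: open_comp; first by move=> x _; exact: continuous_iter.
  exact: open_norm_gt.
exists (fun k =>
    [set x | frequent k [set i | norm_lt k.+1%:R^-1 (iter i T x)]] `&`
    [set x | frequent k [set i | norm_gt k%:R (iter i T x)]]); split=> [n|x xUV].
  by split; [exact: openI|apply: denseI].
have [A A1 Alt] : exists2 A : set nat, upper_density R A = 1 & forall k,
    exists N, forall i, A i -> (N <= i)%N -> norm_lt k.+1%:R^-1 (iter i T x).
  apply: frequent_diagonal; last by move=> k; have [] := xUV k I.
  move=> k i /= /lt_le_trans; apply.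
  by rewrite lef_pV2 ?posrE ?ltr0n// ler_nat.
have [B B1 Bgt] : exists2 A : set nat, upper_density R A = 1 & forall k,
    exists N, forall i, A i -> (N <= i)%N -> norm_gt k%:R (iter i T x).
  apply: frequent_diagonal; last by move=> k; have [] := xUV k I.
  by move=> k i /=; apply: le_lt_trans; rewrite ler_nat.
exists A, B; split=> //; split=> //; split=> // e /archi [n ne].
have [N HN] := Alt n; exists N => i Ai Ni.
by apply: lt_trans ne; exact: HN.
Qed.

End orbits.
Arguments norm_lt {K X} r.
Arguments norm_gt {K X} r.

(** * Hitting frequencies of ergodic transformations *)

Section measure_preserving.
Context (d : measure_display) (W : measurableType d) (R : realType).
Context (mu : probability W R) (T : W -> W).
Hypothesis mT : measurable_fun setT T.
Hypothesis invT : forall A : set W, measurable A -> mu (T @^-1` A) = mu A.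

Lemma measurable_preimageT (A : set W) :
  measurable A -> measurable (T @^-1` A).
Proof. by move=> mA; rewrite -[X in measurable X]setTI; exact: mT. Qed.

Lemma iter_preimageS (A : set W) i :
  iter i.+1 T @^-1` A = T @^-1` (iter i T @^-1` A).
Proof. by apply/predeqP => x; rewrite /preimage /mkset iterSr. Qed.

Lemma measurable_iter_preimage (A : set W) i :
  measurable A -> measurable (iter i T @^-1` A).
Proof.
move=> mA; elim: i => [//|i IH].
by rewrite iter_preimageS; exact: measurable_preimageT.
Qed.

Lemma measure_iter_preimage (A : set W) i :
  measurable A -> mu (iter i T @^-1` A) = mu A.
Proof.
move=> mA; elim: i => [//|i IH].
by rewrite iter_preimageS invT ?IH//; exact: measurable_iter_preimage.
Qed.

Definition hits (A : set W) (N : nat) (x : W) : nat :=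
  count_upto [set i | A (iter i T x)] N.

Lemma measurable_hits_ge (A : set W) m N :
  measurable A -> measurable [set x | (m <= hits A N x)%N].
Proof.
move=> mA; elim: N m => [|N IH] [|m].
- by rewrite (_ : mkset _ = setT) ?predeqE//; exact: measurableT.
- by rewrite (_ : mkset _ = set0) ?predeqE// => x; rewrite /hits /= count_upto0.
- by rewrite (_ : mkset _ = setT) ?predeqE//; exact: measurableT.
rewrite (_ : mkset _ = [set x | (m.+1 <= hits A N x)%N] `|`
   ([set x | (m <= hits A N x)%N] `&` iter N.+1 T @^-1` A)).
  apply: measurableU; first exact: IH.
  by apply: measurableI; [exact: IH|exact: measurable_iter_preimage].
apply/predeqP => x /=; rewrite /hits count_uptoS.
case: asboolP => Ox /=; rewrite ?addn1 ?addn0 ?ltnS; split.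
- by right.
- by case=> [|[]//]; exact: ltnW.
- by left.
- by case=> [|[]].
Qed.

(** The slack [j] is there to absorb the bounded change of the counts when [x] is replaced by
    [T x]. *)
Lemma measurable_hits_mul_ge (A : set W) b c j N :
  measurable A -> measurable [set x | (b <= c * hits A N x + j)%N].
Proof.
move=> mA.
rewrite (_ : mkset _ = \bigcup_(m in [set m | (b <= c * m + j)%N])
    [set x | (m <= hits A N x)%N]).
  by apply: bigcup_measurable => ? _; exact: measurable_hits_ge.
apply/predeqP => x; split=> [bx|[m bm mx]]; first by exists (hits A N x) => //=.
rewrite /= (leq_trans bm)// leq_add2r leq_mul2l; apply/orP; right; exact: mx.
Qed.

(* Markov's inequality for the hitting count, whose mean is [N * mu A]. *)
Lemma measure_hits_ge (A : set W) k N : measurable A -> (0 < N)%N ->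
  (k.+1%:R%:E * mu A <=
   k%:R%:E + k.+1%:R%:E * mu [set x | (k * N <= k.+1 * hits A N x + 0)%N])%E.
Proof.
move=> mA0 N0; set F := [set x | _].
have mF : measurable F by exact: measurable_hits_mul_ge.
have mA i : measurable (iter i T @^-1` A) by exact: measurable_iter_preimage.
pose f i x := (k.+1%:R%:E * (\1_(iter i T @^-1` A) x)%:E : \bar R)%E.
(* [g] dominates the sum of the [f i]: off [F] that sum is below [k * N], on [F] it is at most
   [(k + 1) * N]. Integrating and dividing by [N] gives the claim. *)
pose g x := ((k * N)%:R%:E + (k.+1 * N)%:R%:E * (\1_F x)%:E : \bar R)%E.
have fint i : (\int[mu]_x f i x = k.+1%:R%:E * mu A)%E.
  rewrite ge0_integralZl_EFin//.
    by rewrite integral_indic// setIT; congr (_ * _)%E; exact: measure_iter_preimage.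
  by apply/measurable_EFinP; exact: measurable_indic.
have mf i : measurable_fun setT (f i).
  by apply: measurable_funeM; apply/measurable_EFinP; exact: measurable_indic.
have mg : measurable_fun setT (fun x => ((k.+1 * N)%:R%:E * (\1_F x)%:E : \bar R)%E).
  by apply: measurable_funeM; apply/measurable_EFinP; exact: measurable_indic.
have gint : (\int[mu]_x g x = (k * N)%:R%:E + (k.+1 * N)%:R%:E * mu F)%E.
  rewrite ge0_integralD//= integral_cst//=; congr (_ + _)%E.
    by rewrite -[RHS]mule1; congr (_ * _)%E; exact: probability_setT.
  rewrite ge0_integralZl_EFin//; first by rewrite integral_indic// setIT.
  by apply/measurable_EFinP; exact: measurable_indic.
have sumE x : (\sum_(i <- index_iota 1 N.+1) f i x)%E = (k.+1 * hits A N x)%:R%:E.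
  rewrite /f /hits /count_upto natrM natr_sum EFinM -ge0_sume_distrr//.
  rewrite sumEFin; congr (_ * (_)%:E)%E; apply: eq_bigr => i _.
have : (\int[mu]_x (\sum_(i <- index_iota 1 N.+1) f i x)%E <= \int[mu]_x g x)%E.
  apply: ge0_le_integral => //.
  - by move=> x _; rewrite sumE lee_fin.
  - exact: emeasurable_sum.
  - exact: emeasurable_funD.
  move=> x _; rewrite sumE /g -EFinM -EFinD lee_fin indicE.
  case: (pselect (F x)) => Fx.
    rewrite mem_set// mulr1 -natrD ler_nat.
    by have := count_upto_le [set i | A (iter i T x)] N; rewrite /hits; nia.
  rewrite memNset// mulr0 addr0 ler_nat ltnW//.
  by move/negP: Fx; rewrite -ltnNge addn0.
rewrite gint ge0_integral_sum//; last by move=> i x _; rewrite mule_ge0// lee_fin.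
rewrite (eq_bigr (fun=> k.+1%:R%:E * mu A)%E)//.
have [a aE] : exists a, mu A = a%:E.
  by exists (fine (mu A)); rewrite fineK// fin_num_measure.
have [b bE] : exists b, mu F = b%:E.
  by exists (fine (mu F)); rewrite fineK// fin_num_measure.
rewrite aE bE -!EFinM -!EFinD sumEFin !lee_fin.
rewrite sumr_const_nat subn1 /= -(mulr_natr (_ * a)) !natrM.
by rewrite (mulrAC _ N%:R b) -mulrDl ler_pM2r// ltr0n.
Qed.

(** Continuity of [mu] from above along the tail unions, each of which contains the set [F n.+1] of
    positive index. *)
Lemma measure_lim_sup_set_ge (F : nat -> set W) (c : \bar R) :
  (forall N, measurable (F N)) -> (forall N, (0 < N)%N -> (c <= mu (F N))%E) ->
  (c <= mu (lim_sup_set F))%E.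
Proof.
move=> mF cF.
have finF : (mu (\bigcup_(k in [set k | (0 <= k)%N]) F k) < +oo)%E.
  apply: le_lt_trans (probability_le1 mu _) (ltry 1).
  exact: bigcup_measurable.
rewrite -(cvg_lim _ (lim_sup_set_cvg mu F mF finF))//.
apply: lime_ge; first by apply/cvg_ex; eexists; exact: lim_sup_set_cvg.
apply: nearW => n; apply: le_trans (cF n.+1 _) _ => //.
apply: le_measure; rewrite ?inE//; first exact: bigcup_measurable.
by apply: bigcup_sup => /=.
Qed.

(* The asymptotic hitting frequency is [T]-invariant, so the zero-one law and
   the mean value of the hitting counts give the lower bound of Birkhoff's
   theorem, which is all that is needed. *)
Lemma ergodic_frequent (A : set W) k :
  (forall B, measurable B -> T @^-1` B = B -> mu B = 0%E \/ mu B = 1%E) ->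
  measurable A -> (k.+1%:R%:E < k.+2%:R%:E * mu A)%E ->
  exists E : set W, [/\ measurable E, mu E = 1%E &
    forall x, E x -> frequent k [set i | A (iter i T x)]].
Proof.
move=> erg mA kA.
(* The ratio [(k+1)/(k+2)] is one level above the required one, which leaves room to drop [j] at
   late times. The union over [j] makes [E] insensitive to bounded errors, hence invariant. *)
pose F j N := [set x | (k.+1 * N <= k.+2 * hits A N x + j)%N].
pose E := \bigcup_j lim_sup_set (F j).
have mF j N : measurable (F j N) by exact: measurable_hits_mul_ge.
have mL j : measurable (lim_sup_set (F j)).
  by apply: bigcap_measurable => // n _; exact: bigcup_measurable.
have mE : measurable E by exact: bigcup_measurable.
have hitsT N x : (hits A N (T x) <= hits A N.+1 x <= (hits A N (T x)).+1)%N.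
  have E1 : hits A N.+1 x = (`[< A (T x) >] + hits A N (T x))%N.
    rewrite /hits count_upto_shift; congr (_ + count_upto _ _)%N.
    by apply/predeqP => i; rewrite /mkset iterSr.
  by rewrite E1; case: `[< _ >]; lia.
(* The slack grows by [k + 1] when the window gains an index, and by [k + 2] when a hit is lost. *)
have TE : T @^-1` E = E.
  apply/predeqP => x; split=> -[j _ jx].
    exists (j + k.+1)%N => // n _; have [N /= nN FN] := jx n I.
    exists N.+1 => /=; first exact: leqW.
    by move: FN (hitsT N x); rewrite /F /=; nia.
  exists (j + k.+2)%N => // n _; have [[//|N] /= nN FN] := jx n.+1 I.
  by exists N => //=; move: FN (hitsT N x); rewrite /F /=; nia.
have E0 : mu E != 0%E.
  have [a aE] : exists a, mu A = a%:E.
    by exists (fine (mu A)); rewrite fineK// fin_num_measure.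
  move: kA; rewrite aE -EFinM lte_fin => kA.
  rewrite gt_eqF// (@lt_le_trans _ _ (a - k.+1%:R / k.+2%:R)%:E)//.
    by rewrite lte_fin subr_gt0 ltr_pdivrMr// mulrC.
  apply: (@le_trans _ _ (mu (lim_sup_set (F 0%N)))); last first.
    by apply: le_measure; rewrite ?inE// => x Fx; exists 0%N.
  apply: measure_lim_sup_set_ge => // N N0.
  have := @measure_hits_ge A k.+1 N mA N0; rewrite -/(F 0%N N) aE.
  have [b ->] : exists b, mu (F 0%N N) = b%:E.
    by exists (fine (mu (F 0%N N))); rewrite fineK// fin_num_measure.
  rewrite -!EFinM -EFinD !lee_fin => ab.
  rewrite lerBlDr -(ler_pM2l (_ : 0 < k.+2%:R))// mulrDr mulrCA divff ?mulr1//.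
  by rewrite addrC.
exists E; split=> //; first by have [/eqP|//] := erg E mE TE; rewrite (negbTE E0).
(* Since [(k+1)^2 = k (k+2) + 1], multiplying the inequality by [k + 1] gains [N] and costs
   [(k+1) j]; hence a time [N] of at least [k + (k+1) j]. *)
move=> x [j _ jx]; have [N /= nN FN] := jx (k + k.+1 * j)%N I.
exists N; first by lia.
by move: FN; rewrite /F /= /hits; nia.
Qed.

End measure_preserving.

(** * Operators with an ergodic measure of full support *)

Lemma open_measurable_Borel (X : ptopologicalType) (A : set X) :
  open A -> measurable (A : set (Borel X)).
Proof. exact: sub_sigma_algebra. Qed.

Lemma continuous_measurable_Borel (X : ptopologicalType) (T : X -> X) :
  continuous T -> measurable_fun setT (T : Borel X -> Borel X).
Proof.
move=> cT; apply: (@measurability _ _ (Borel X) (Borel X) setT T (@open X)) => //.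
move=> _ [A oA <-]; rewrite setTI; apply: open_measurable_Borel.
by apply: open_comp => // x _; exact: cT.
Qed.

Lemma closed_set1_normed (K : numFieldType) (X : normedModType K) (x : X) :
  closed [set x].
Proof. by apply: accessible_closed_set1; exact: hausdorff_accessible. Qed.

Section scaling.
Context (K : numFieldType) (X : normedModType K).

Lemma linear_iterZ (T : {linear X -> X}) i (r : K) (x : X) :
  iter i T (r *: x) = r *: iter i T x.
Proof. by elim: i => //= i ->; rewrite linearZ. Qed.

Lemma dense_scale (r : K) (S S' : set X) : r != 0 ->
  dense S -> (forall y, S y -> S' (r *: y)) -> dense S'.
Proof.
move=> r0 dS SS' O [x Ox] oO.
have [||y [Oy Sy]] := dS ((fun y => r *: y) @^-1` O).
- by exists (r^-1 *: x); rewrite /= scalerA divff// scale1r.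
- by apply: open_comp => // y _; exact: scaler_continuous.
by exists (r *: y); split => //; exact: SS'.
Qed.

End scaling.

Section ergodic_operator.
Context (K : numFieldType) (X : normedModType K) (R : realType).
Context (T : {linear X -> X}) (mu : probability (Borel X) R).
Hypothesis cT : continuous T.
Hypothesis ergT : ergodic T mu.
Hypothesis suppT : full_support mu.

Lemma full_measure_meets_open (E : set (Borel X)) (O : set X) :
  measurable E -> mu E = 1%E -> open O -> O !=set0 -> exists x, O x /\ E x.
Proof.
move=> mE muE oO O0; apply/not_existsP => OE.
have : (mu (~` E) = 0)%E by rewrite probability_setC// muE subee.
apply/eqP; rewrite gt_eqF//.
suff : (mu O <= mu (~` E))%E by apply: lt_le_trans; exact: suppT.
apply: le_measure; rewrite ?inE.
- exact: open_measurable_Borel.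
- exact: measurableC.
- by move=> x Ox Ex; exact: (OE x).
Qed.

(** Some [A n] has measure above [(k+1)/(k+2)], and the resulting set of full measure meets every
    nonempty open set by full support. The index [n] depends on [k]; rescaling will compensate for
    this. *)
Lemma ergodic_dense_frequent (A : nat -> set X) k :
  (forall n, open (A n)) -> (forall n, A n `<=` A n.+1) ->
  mu (\bigcup_n A n) = 1%E ->
  exists n, dense [set x | frequent k [set i | A n (iter i T x)]].
Proof.
move=> oA ndA muA.
have mA n : measurable (A n : set (Borel X)) by exact: open_measurable_Borel.
have [n kn] : exists n, (k.+1%:R%:E < k.+2%:R%:E * mu (A n))%E.
  apply/not_existsP => Hn.
  have : (mu (\bigcup_n A n) <= (k.+1%:R / k.+2%:R)%:E)%E.
    have cA : (mu \o A) x @[x --> \oo] --> mu (\bigcup_n A n).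
      apply: nondecreasing_cvg_mu => //; first exact: bigcup_measurable.
      apply/nondecreasing_seqP => n; exact/subsetPset/ndA.
    rewrite -(cvg_lim _ cA)//; apply: lime_le; first by apply/cvg_ex; eexists; exact: cA.
    apply: nearW => n /=; move/negP: (Hn n); rewrite -leNgt.
    have [a ->] : exists a, mu (A n) = a%:E.
      by exists (fine (mu (A n))); rewrite fineK// fin_num_measure.
    by rewrite -EFinM !lee_fin ler_pdivlMr// mulrC.
  by rewrite muA lee_fin ler_pdivlMr// mul1r ler_nat ltnn.
exists n; move=> O O0 oO.
have [inv erg] := ergT.
have [E [mE muE EF]] := @ergodic_frequent _ (Borel X) R mu T
  (@continuous_measurable_Borel _ _ cT) inv (A n) k erg (mA n) kn.
have [x [Ox Ex]] := @full_measure_meets_open E O mE muE oO O0.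
by exists x; split => //; exact: EF.
Qed.

Hypothesis archiK : forall a : K, 0 <= a -> exists n : nat, a < n%:R.
Hypothesis X0 : exists x : X, x != 0.

(** [T] may have a kernel, so the zero-one law is applied to the increasing union of the iterated
    preimages of [{0}], which is invariant and has the same measure. Measure [1] would contradict
    full support off the origin. *)
Lemma ergodic_measure_set1_0 : mu ([set 0] : set (Borel X)) = 0%E.
Proof.
have [inv erg] := ergT.
have cl0 := @closed_set1_normed K X 0.
have m0 : measurable ([set 0] : set (Borel X)).
  rewrite -[X in measurable X]setCK; apply: measurableC.
  by apply: open_measurable_Borel; exact: closed_openC.
have mT := @continuous_measurable_Borel _ _ cT.
pose Z n : set (Borel X) := iter n T @^-1` [set 0].
have mZ n : measurable (Z n) by apply: measurable_iter_preimage m0.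
have ndZ n : Z n `<=` Z n.+1 by move=> x; rewrite /Z /= => ->; rewrite linear0.
have muZ : mu (\bigcup_n Z n) = mu ([set 0] : set (Borel X)).
  have cZ : (mu \o Z) x @[x --> \oo] --> mu (\bigcup_n Z n).
    apply: nondecreasing_cvg_mu => //; first exact: bigcup_measurable.
    by apply/nondecreasing_seqP => n; exact/subsetPset/ndZ.
  rewrite -(cvg_lim _ cZ)//; apply: lim_near_cst => //.
  by apply: nearW => n; apply: measure_iter_preimage.
have TZ : T @^-1` (\bigcup_n Z n) = \bigcup_n Z n.
  apply/predeqP => x; split=> -[n _ nx].
    by exists n.+1 => //; move: nx; rewrite /Z /preimage /mkset iterSr.
  exists n => //; move: (ndZ _ _ nx); rewrite /Z /preimage /mkset iterSr; exact.
have [|] := erg _ (bigcup_measurable (fun n _ => mZ n)) TZ; rewrite muZ // => mu1.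
have [x x0] := X0.
have [|y [y0 /= yE]] := @full_measure_meets_open _ (~` [set 0]) m0 mu1 (closed_openC cl0).
  by exists x; exact/eqP.
by [].
Qed.

Lemma ergodic_dense_norm_lt k :
  dense [set x | frequent k [set i | norm_lt k.+1%:R^-1 (iter i T x)]].
Proof.
have [|n||n dn] := @ergodic_dense_frequent (fun n => norm_lt n%:R) k.
- by move=> n; exact: open_norm_lt.
- by move=> x /lt_le_trans; apply; rewrite ler_nat.
- rewrite (_ : \bigcup_n _ = setT) ?probability_setT//.
  by apply/predeqP => x; split => // _; have [n xn] := archiK `|x| (normr_ge0 x); exists n.
(* This factor sends the ball of radius [n] into that of radius [1/(k+1)]; using [n.+1] keeps it
   nonzero when [n = 0]. *)
apply: (@dense_scale _ _ (k.+1%:R * n.+1%:R)^-1 _ _ _ dn).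
  by rewrite invr_eq0 mulf_neq0 ?pnatr_eq0.
move=> y; apply: frequent_sub => i; rewrite /norm_lt /= linear_iterZ normrZ => yn.
rewrite normfV normrM !normr_nat invfM -mulrA gtr_pMr ?invr_gt0 ?ltr0n//.
rewrite ltr_pdivrMl ?ltr0n// mulr1; apply: lt_trans yn _.
by rewrite ltr_nat.
Qed.

Lemma ergodic_dense_norm_gt k :
  dense [set x | frequent k [set i | norm_gt k%:R (iter i T x)]].
Proof.
have [|n||n dn] := @ergodic_dense_frequent (fun n => norm_gt n.+1%:R^-1) k.
- by move=> n; exact: open_norm_gt.
- move=> x /=; rewrite /norm_gt /=; apply: le_lt_trans.
  by rewrite lef_pV2 ?posrE ?ltr0n// ler_nat.
- have m0 : measurable (~` [set 0] : set (Borel X)).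
    by apply: open_measurable_Borel; apply: closed_openC; exact: closed_set1_normed.
  rewrite (_ : \bigcup_n _ = ~` [set 0]); last first.
    apply/predeqP => x; split => [[n _] /[swap] ->|/eqP x0].
      by rewrite /norm_gt /= normr0 invr_lt0 ltrn0.
    have [|n xn] := archiK (`|x|^-1); first by rewrite invr_ge0.
    exists n => //; rewrite /norm_gt /= -[X in _ < X]invrK.
    rewrite ltf_pV2 ?posrE ?invr_gt0 ?normr_gt0 ?ltr0n//.
    by apply: lt_trans xn _; rewrite ltr_nat.
  rewrite probability_setC; last by rewrite -[X in measurable X]setCK; exact: measurableC.
  by rewrite ergodic_measure_set1_0 sube0.
apply: (@dense_scale _ _ (k.+1%:R * n.+1%:R) _ _ _ dn).
  by rewrite mulf_neq0 ?pnatr_eq0.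
move=> y; apply: frequent_sub => i; rewrite /norm_gt /= linear_iterZ normrZ => yn.
rewrite normrM !normr_nat -mulrA; apply: (@lt_trans _ _ k.+1%:R); first by rewrite ltr_nat.
by rewrite ltr_pMr ?ltr0n// -ltr_pdivrMl ?ltr0n// mulr1.
Qed.

End ergodic_operator.

(** * Sparse sets and powers of unimodular numbers *)

(** Density at most [1/k], with an error [B] uniform in [N]. Unlike [frequent], this concerns all
    windows, so it passes to a union of two sets that are each twice as sparse. *)
Definition sparse (k : nat) (P : set nat) :=
  exists B, forall N, (k * count_upto P N <= N + B)%N.

Lemma sparse_sub k (P Q : set nat) : P `<=` Q -> sparse k Q -> sparse k P.
Proof.
move=> PQ [B HB]; exists B => N; apply: leq_trans (HB N).
by rewrite leq_mul2l count_upto_mono ?orbT// => i _; exact: PQ.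
Qed.

Lemma sparse0 k : sparse k set0.
Proof.
exists 0%N; elim=> [|N IH]; first by rewrite count_upto0 muln0.
by rewrite count_uptoS asboolF//; lia.
Qed.

Lemma sparseU k (P Q : set nat) :
  sparse (2 * k) P -> sparse (2 * k) Q -> sparse k (P `|` Q).
Proof.
move=> [B HB] [C HC]; exists (B + C)%N => N.
by have := count_uptoU P Q N; have := HB N; have := HC N; nia.
Qed.

Lemma sparse_frequent k (P : set nat) : sparse k.+2 (~` P) -> frequent k P.
Proof.
(* For [N >= (k+1) B] one has [(k+1) (N + B) <= (k+2) N], so the complement has frequency at most
   [1/(k+1)]. *)
move=> [B HB]; exists (k + k.+1 * B)%N; first by lia.
set N := (k + _)%N; have NB : (k.+1 * B <= N)%N by rewrite /N; lia.
by have := HB N; have := count_uptoC P N; move: NB; clearbody N; nia.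
Qed.

Lemma count_upto_translate (P : set nat) s N :
  (count_upto P N <= count_upto [set i | P (i + s)%N] N + s)%N.
Proof.
elim: s P => [|s IH] P.
  by rewrite addn0; apply: count_upto_mono => i _; rewrite /= addn0.
have E : (count_upto P N <= (count_upto (fun i => P i.+1) N).+1)%N.
  have : (count_upto P N <= count_upto P N.+1)%N by rewrite count_uptoS leq_addr.
  by rewrite count_upto_shift; case: `[< _ >]; lia.
apply: leq_trans E _; rewrite addnS ltnS; apply: leq_trans (IH _) _.
by rewrite leq_add2r; apply: count_upto_mono => i _; rewrite /= addnS.
Qed.

(** The translates of [P] by the [- s a] are disjoint, so their counts on [[1, N]] add up to at most
    [N], and each falls short of the count of [P] by at most [s a]. *)
Lemma sparse_packing L (s : 'I_L -> nat) (P : set nat) :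
  (forall n a b, P (n + s a)%N -> P (n + s b)%N -> a = b) -> sparse L P.
Proof.
move=> sP; exists (\sum_a s a)%N => N.
have le1 n : (\sum_(a < L) `[< P (n + s a)%N >] <= 1)%N.
  have [[a Pa]|nP] := pselect (exists a, P (n + s a)%N).
    rewrite (bigD1 a)//= big1 ?addn0 ?leq_b1// => b ba.
    by rewrite asboolF// => Pb; move/eqP: ba; apply; exact: sP Pb Pa.
  by rewrite big1// => b _; rewrite asboolF// => Pb; apply: nP; exists b.
have sum_le : (\sum_(a < L) count_upto [set i | P (i + s a)%N] N <= N)%N.
  elim: N => [|N IH]; first by rewrite big1// => a _; rewrite count_upto0.
  under eq_bigr do rewrite count_uptoS.
  by rewrite big_split /= -[leqRHS]addn1 leq_add.
apply: (@leq_trans (\sum_(a < L) (count_upto [set i | P (i + s a)%N] N + s a))).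
  rewrite -[X in (X * _)%N]card_ord -sum_nat_const.
  by apply: leq_sum => a _; exact: count_upto_translate.
by rewrite big_split /= leq_add2r.
Qed.

Section unimodular.
Context (C : numClosedFieldType).
Hypothesis archiC : forall a : C, 0 <= a -> exists n : nat, a < n%:R.

Lemma norm_geometric_sum_le (w : C) N : `|w| = 1 -> w != 1 ->
  `|\sum_(1 <= i < N.+1) w ^+ i| <= 2 / `|1 - w|.
Proof.
move=> w1 wn1; rewrite big_add1 /= big_mkord.
under eq_bigr do rewrite exprS.
rewrite -mulr_sumr normrM w1 mul1r ler_pdivlMr ?normr_gt0 ?subr_eq0 1?eq_sym//.
rewrite -normrM mulrC -opprB mulNr -subrX1 normrN (le_trans (ler_normB _ _))//.
by rewrite normrX w1 expr1n normr1.
Qed.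

(** As the conjugate of [l i] is its inverse, the square expands into the powers of [l j / l i]: the
    diagonal contributes [#|I| * N], the other geometric sums are bounded independently of [N]. *)
Lemma mean_square_le (I : finType) (l : I -> C) :
  injective l -> (forall j, `|l j| = 1) ->
  exists B : C, 0 <= B /\ forall N,
    \sum_(1 <= n < N.+1) `|\sum_j l j ^+ n| ^+ 2 <= #|I|%:R * N%:R + B.
Proof.
move=> linj l1.
have l0 j : l j != 0 by rewrite -normr_gt0 l1.
pose b j i : C := if i == j then 0 else 2 / `|1 - l j / l i|.
have b0 j i : 0 <= b j i by rewrite /b; case: ifP => // _; rewrite divr_ge0.
exists (\sum_j \sum_i b j i); split=> [|N].
  by apply: sumr_ge0 => j _; apply: sumr_ge0 => i _.
have lC j : (l j)^* = (l j)^-1 by rewrite invC_norm l1 expr1n invr1 mul1r.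
have sq n : `|\sum_j l j ^+ n| ^+ 2 = \sum_j \sum_i (l j / l i) ^+ n.
  rewrite normCK rmorph_sum mulr_suml; apply: eq_bigr => j _.
  rewrite mulr_sumr; apply: eq_bigr => i _.
  by rewrite rmorphXn /= lC -exprMn.
(* The expanded terms need not be real; taking the norm makes the triangle inequality available. *)
rewrite -[leLHS]ger0_norm; last first.
  by apply: sumr_ge0 => n _; rewrite exprn_ge0.
under eq_bigr do rewrite sq.
rewrite exchange_big /=.
under eq_bigr do rewrite exchange_big /=.
apply: (@le_trans _ _ (\sum_j \sum_i ((i == j)%:R * N%:R + b j i))).
  apply: le_trans (ler_norm_sum _ _ _) _; apply: ler_sum => j _.
  apply: le_trans (ler_norm_sum _ _ _) _; apply: ler_sum => i _.
  rewrite /b; case: eqVneq => [->|ij].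
    rewrite mul1r addr0 divff//.
    under eq_bigr do rewrite expr1n.
    by rewrite sumr_const_nat subn1 normr_nat.
  rewrite mul0r add0r norm_geometric_sum_le//.
    by rewrite normrM normfV !l1 invr1 mulr1.
  rewrite -subr_eq0 -(inj_eq (mulIf (l0 i))) mulrBl mul0r divfK// mul1r subr_eq0.
  by rewrite inj_eq// eq_sym.
rewrite (eq_bigr (fun j => N%:R + \sum_i b j i)) => [|j _].
  by rewrite big_split /= sumr_const mulr_natl.
rewrite big_split /= (bigD1 j)//= eqxx mul1r big1 ?addr0// => i /negbTE ->.
by rewrite mul0r.
Qed.

Lemma count_upto_sum_le (tau : C) (u : nat -> C) N : 0 <= tau -> (forall n, 0 <= u n) ->
  tau * (count_upto [set n | ~ (u n < tau)] N)%:R <= \sum_(1 <= n < N.+1) u n.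
Proof.
move=> tau0 u0; elim: N => [|N IH]; first by rewrite count_upto0 mulr0 big_geq.
rewrite count_uptoS natrD mulrDr big_nat_recr//= lerD//.
case: asboolP => [|_]; last by rewrite mulr0.
by rewrite mulr1 => /negP; rewrite -real_leNgt// ger0_real.
Qed.

(** Chebyshev's inequality: the exceptional density is at most [1 / (m.+1 * tau ^+ 2)]. The size [m]
    is fixed before [l], so that the eigenvalues can be chosen afterwards. *)
Lemma sparse_mean_large (tau : C) k : 0 < tau -> exists m : nat, forall l : 'I_m.+1 -> C,
  injective l -> (forall j, `|l j| = 1) ->
  sparse k [set n | ~ (`|m.+1%:R^-1 * \sum_j l j ^+ n| < tau)].
Proof.
move=> tau0.
have [m mk] : exists m : nat, k%:R / tau ^+ 2 < m%:R.
  by apply: archiC; rewrite divr_ge0// exprn_ge0// ltW.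
exists m => l linj l1.
have m0 : 0 < m.+1%:R :> C by rewrite ltr0n.
have [B [B0 HB]] := mean_square_le _ l linj l1.
have [b Bb] := archiC _ B0; exists b => N.
rewrite -(ler_nat C) natrM natrD -(ler_pM2l m0) mulrDr.
set P := [set n | _].
have H : (m.+1%:R * tau) ^+ 2 * (count_upto P N)%:R <= m.+1%:R * N%:R + B.
  have := HB N; rewrite card_ord; apply: le_trans.
  have mt0 : 0 <= (m.+1%:R * tau) ^+ 2 by rewrite exprn_ge0// mulr_ge0// ltW.
  apply: le_trans (@count_upto_sum_le _ _ N mt0 _); last by move=> n; rewrite exprn_ge0.
  rewrite ler_wpM2l// ler_nat; apply: count_upto_mono => n _; rewrite /P /=.
  apply: contra_not => h; rewrite normrM normfV normr_nat ltr_pdivrMl//.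
  by rewrite -(@ltr_pXn2r _ 2)// nnegrE// mulr_ge0// ltW.
apply: (@le_trans _ _ (m.+1%:R * N%:R + B)); last first.
  by rewrite lerD2l (le_trans (ltW Bb))// ler_peMl// ler1n.
apply: le_trans H; rewrite mulrA ler_wpM2r// exprMn expr2 -!mulrA ler_pM2l//.
by rewrite -ler_pdivrMr ?exprn_gt0// (le_trans (ltW mk))// ler_nat.
Qed.

(** Descend from [n] while the values stay at least [t]: where this stops before [0], the preceding
    value is below [t] and one step adds at most [r]. *)
Lemma discrete_ivt (u : nat -> C) (r t : C) n : (forall n, 0 <= u n) -> 0 <= t ->
  u 0%N = 0 -> 0 <= r -> (forall n, u n.+1 <= u n + r) -> t <= u n ->
  exists s, t <= u s <= t + r.
Proof.
move=> u0 t0 u00 r0 ur; elim: n => [|n IH] tu.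
  by exists 0%N; rewrite tu u00 addr_ge0.
have [tn|nt] := real_leP (ger0_real t0) (ger0_real (u0 n)); first exact: IH.
by exists n.+1; rewrite tu (le_trans (ur n))// lerD2r ltW.
Qed.

(** If all powers were within [1/2] of [1], their sum over [[1, N]] would have norm at least
    [N / 2], against the bound on geometric sums. *)
Lemma unimodular_power_far (w : C) : `|w| = 1 -> w != 1 ->
  exists n, 2^-1 <= `|1 - w ^+ n|.
Proof.
move=> w1 wn1; apply/not_existsP => H.
have Hlt n : `|1 - w ^+ n| <= 2^-1.
  apply/ltW; rewrite real_ltNge ?normr_real ?gtr0_real ?invr_gt0//; exact/negP/H.
have [|N NB] := archiC (2 * (2 / `|1 - w|)).
  by rewrite mulr_ge0// divr_ge0.
have := norm_geometric_sum_le w N w1 wn1.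
apply/negP; rewrite -real_ltNge ?normr_real ?ger0_real ?divr_ge0//.
have : N%:R / 2 <= `|\sum_(1 <= i < N.+1) w ^+ i|; last first.
  by apply: lt_le_trans; rewrite ltr_pdivlMr// mulrC.
have h : `|\sum_(1 <= i < N.+1) (1 - w ^+ i)| <= N%:R / 2.
  apply: le_trans (ler_norm_sum _ _ _) _.
  apply: (@le_trans _ _ (\sum_(1 <= i < N.+1) 2^-1)).
    by apply: ler_sum => i _.
  by rewrite sumr_const_nat subn1 mulr_natl.
rewrite -(lerD2r (N%:R / 2)) -splitr.
apply: le_trans (lerD (lexx _) h).
rewrite -[leLHS]normr_nat; apply: le_trans (ler_normD _ _).
rewrite -big_split /=; under eq_bigr do rewrite addrC subrK.
by rewrite sumr_const_nat subn1.
Qed.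

(* Powers of [w] whose distances to [1] are close to [a / (2 L)], [a < L], are
   pairwise separated, so the corresponding translates of the return set are
   disjoint. *)
Lemma sparse_returns (w : C) L : (0 < L)%N -> `|w| = 1 -> w != 1 ->
  `|1 - w| <= (4 * L)%:R^-1 ->
  sparse L [set n | ~ ((8 * L)%:R^-1 <= `|1 - w ^+ n|)].
Proof.
move=> L0 w1 wn1 wL.
have L0' : 0 < L%:R :> C by rewrite ltr0n.
have [n0 far] := unimodular_power_far w w1 wn1.
have wX n : `|w ^+ n| = 1 by rewrite normrX w1 expr1n.
have step n : `|1 - w ^+ n.+1| <= `|1 - w ^+ n| + `|1 - w|.
  have -> : 1 - w ^+ n.+1 = (1 - w ^+ n) + w ^+ n * (1 - w) by rewrite exprSr; ring.
  by apply: le_trans (ler_normD _ _) _; rewrite normrM wX mul1r.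
have /choice [s sP] (a : 'I_L) : exists s,
    a%:R / (2 * L)%:R <= `|1 - w ^+ s| <= a%:R / (2 * L)%:R + `|1 - w|.
  apply: (@discrete_ivt (fun n => `|1 - w ^+ n|) _ _ n0) => //.
  - by rewrite expr0 subrr normr0.
  - apply: le_trans far; rewrite natrM invfM mulrCA ler_piMr ?invr_ge0//.
    by rewrite ler_pdivrMr// mul1r ler_nat ltnW.
apply: (@sparse_packing _ s) => n.
suff sep (a b : 'I_L) : (a < b)%N ->
    ~ ((8 * L)%:R^-1 <= `|1 - w ^+ (n + s a)|) ->
    ~ ((8 * L)%:R^-1 <= `|1 - w ^+ (n + s b)|) -> False.
  move=> a b Pa Pb; case: (ltngtP a b) => ab; last exact: val_inj.
  - by case: (sep a b ab Pa Pb).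
  - by case: (sep b a ab Pb Pa).
have r8 : (8 * L)%:R^-1 \is @Num.real C by rewrite realV realn.
(* As [a < b], the distance [|1 - w ^+ s b|] is at least [(a+1)/(2L)]. The two returns give
   [|w ^+ s a - w ^+ s b| < 2/(8L)], so it is also below [a/(2L) + 1/(4L) + 2/(8L)], the same
   number. *)
move=> ab /negP; rewrite -real_ltNge ?normr_real// => Pa.
move=> /negP; rewrite -real_ltNge ?normr_real// => Pb.
have [/andP[_ sa] /andP[sb _]] := (sP a, sP b).
have sab : `|1 - w ^+ s b| <= `|1 - w ^+ s a| + `|w ^+ s a - w ^+ s b|.
  have -> : 1 - w ^+ s b = (1 - w ^+ s a) + (w ^+ s a - w ^+ s b) by ring.
  exact: ler_normD.
have nab : `|w ^+ s a - w ^+ s b| <= `|1 - w ^+ (n + s a)| + `|1 - w ^+ (n + s b)|.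
  have -> : `|w ^+ s a - w ^+ s b| = `|w ^+ (n + s a) - w ^+ (n + s b)|.
    by rewrite !exprD -mulrBr normrM wX mul1r.
  have -> : w ^+ (n + s a) - w ^+ (n + s b) =
     - (1 - w ^+ (n + s a)) + (1 - w ^+ (n + s b)) by ring.
  by apply: le_trans (ler_normD _ _) _; rewrite normrN.
have d8 : (8 * L)%:R^-1 + (8 * L)%:R^-1 = (4 * L)%:R^-1 :> C.
  by rewrite !natrM; field; rewrite (gt_eqF L0').
have d4 : (4 * L)%:R^-1 + (4 * L)%:R^-1 = (2 * L)%:R^-1 :> C.
  by rewrite !natrM; field; rewrite (gt_eqF L0').
have := lt_le_trans (ltrD Pa Pb) (lexx _); rewrite d8 => /(le_lt_trans nab) nab'.
have := le_lt_trans sab (ler_ltD sa nab').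
move=> /(le_lt_trans sb); apply/negP; rewrite -real_leNgt.
- rewrite -addrA; apply: (@le_trans _ _ (a%:R / (2 * L)%:R + (2 * L)%:R^-1)).
    by rewrite lerD2l -d4 lerD2r.
  rewrite -[X in _ + X]mul1r -mulrDl ler_pM2r; last by rewrite invr_gt0 ltr0n muln_gt0.
  by rewrite natr1 ler_nat.
- by rewrite !realD ?normr_real ?realM ?realV ?realn.
- by rewrite realM ?realV ?realn.
Qed.

End unimodular.

(** * Operators with many unimodular eigenvectors *)

Section eigenvectors.
Context (C : numClosedFieldType) (X : normedModType C) (T : {linear X -> X}).
Hypothesis archiC : forall a : C, 0 <= a -> exists n : nat, a < n%:R.
Hypothesis cT : continuous T.

Definition unimodular_eigenpair (l : C) (v : X) := `|l| = 1 /\ T v = l *: v.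

Lemma iter_eigen (l : C) (v : X) n : T v = l *: v -> iter n T v = l ^+ n *: v.
Proof.
move=> Tv; elim: n => [|n IH]; first by rewrite expr0 scale1r.
by rewrite iterS IH linearZ /= Tv scalerA exprSr.
Qed.

Lemma linear_iterD n (x y : X) : iter n T (x + y) = iter n T x + iter n T y.
Proof. by elim: n => //= n ->; rewrite linearD. Qed.

Lemma linear_iter_sum (I : Type) (r : seq I) (F : I -> X) n :
  iter n T (\sum_(i <- r) F i) = \sum_(i <- r) iter n T (F i).
Proof.
elim: r => [|i r IH]; last by rewrite !big_cons linear_iterD IH.
by rewrite !big_nil; elim: n => //= n ->; rewrite linear0.
Qed.

(* [D] collects the eigenvalues occurring in those members of a countable base
   of open sets that meet only countably many eigenspaces. *)
Lemma eigenpair_condensation : separable X ->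
  exists2 D : set C, countable D &
    forall l v, unimodular_eigenpair l v -> ~ D l ->
    forall (O : set X) (F : seq C), nbhs v O ->
    exists l' v', [/\ unimodular_eigenpair l' v', l' \notin F & O v'].
Proof.
move=> [Q [cQ dQ]].
pose Lam (q : X) (n : nat) := [set l : C | exists v, unimodular_eigenpair l v /\
  `|v - q| < n.+1%:R^-1].
pose D := \bigcup_(q in Q) \bigcup_(n in [set n | countable (Lam q n)]) Lam q n.
exists D.
  apply: bigcup_countable => // q _.
  by apply: bigcup_countable => //; exact: countable_setT_countMixin.
move=> l v lv Dl O F /nbhs_ballP [e /= e0 eO].
have [n ne] : exists n : nat, 2 / e < n%:R.
  by apply: archiC; rewrite divr_ge0// ltW.
have n0 : 0 < n.+1%:R^-1 :> C by rewrite invr_gt0 ltr0n.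
have en : n.+1%:R^-1 + n.+1%:R^-1 <= e.
  rewrite -[X in X + _]mul1r -[X in _ + X]mul1r -mulrDl ler_pdivrMr ?ltr0n//.
  rewrite mulrC -ler_pdivrMr//; apply: le_trans (ltW ne) _.
  by rewrite ler_nat.
have [||q [vq Qq]] := dQ (ball v n.+1%:R^-1).
- by exists v; exact: ballxx.
- exact: ball_open.
have lLam : Lam q n l.
  by exists v; split => //; move: vq; rewrite -ball_normE.
have ncL : ~ countable (Lam q n) by move=> cL; apply: Dl; exists q => //; exists n.
have [l' Ll' Fl'] : exists2 l', Lam q n l' & l' \notin F.
  apply: contrapT => H; apply: ncL; apply: (@sub_countable _ _ _ [set` F]).
    apply: subset_card_le => l' Ll'; apply: contrapT => /negP Fl'.
    by apply: H; exists l'.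
  by apply: finite_set_countable; exact: finite_seq.
have [v' [lv' vq']] := Ll'.
exists l', v'; split=> //; apply: eO; rewrite -ball_normE /=.
have -> : v - v' = (v - q) + (q - v') by rewrite addrA subrK.
apply: le_lt_trans (ler_normD _ _) _; apply: lt_le_trans en.
apply: ltrD; last by rewrite distrC.
by move: vq; rewrite -ball_normE.
Qed.

(** As [y] may depend on [e] and [k], the property is closed under sums, by halving [e] and doubling
    [k]; it thus extends from eigenvectors to their span. *)
Definition sparsely_large_approx (x : X) := forall (e : C) k, 0 < e ->
  exists2 y, `|x - y| < e & sparse k [set i | ~ norm_lt e (iter i T y)].

Lemma sparsely_large_approxD x x' : sparsely_large_approx x ->
  sparsely_large_approx x' -> sparsely_large_approx (x + x').
Proof.
move=> xG xG' e k e0; have e20 : 0 < e / 2 by rewrite divr_gt0.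
have [y xy ky] := xG (e / 2) (2 * k)%N e20.
have [y' xy' ky'] := xG' (e / 2) (2 * k)%N e20.
exists (y + y').
  rewrite opprD addrACA (splitr e); apply: le_lt_trans (ler_normD _ _) _.
  exact: ltrD.
apply: sparse_sub (sparseU _ _ _ ky ky') => i /=.
apply: contraPP => /not_orP [/contrapT h /contrapT h'] /=; apply.
rewrite /norm_lt /= linear_iterD (splitr e); apply: le_lt_trans (ler_normD _ _) _.
exact: ltrD.
Qed.

Lemma sparsely_large_approx_sum n (v : 'I_n -> X) :
  (forall i, sparsely_large_approx (v i)) -> sparsely_large_approx (\sum_i v i).
Proof.
move=> vG; apply: big_ind => //; last exact: sparsely_large_approxD.
move=> e k e0; exists 0; first by rewrite subrr normr0.
apply: sparse_sub (sparse0 k) => i /=; apply.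
by rewrite /norm_lt /= -[X in iter _ _ X](scale0r 0) linear_iterZ scale0r normr0.
Qed.

(* An eigenvector is replaced by an average of nearby eigenvectors with distinct
   eigenvalues: along the orbit, the average of the powers of these eigenvalues
   is small in mean square. *)
Lemma eigenvector_sparsely_large (v : X) :
  (forall (O : set X) (F : seq C), nbhs v O ->
    exists l' v', [/\ unimodular_eigenpair l' v', l' \notin F & O v']) ->
  sparsely_large_approx v.
Proof.
move=> cond e k e0.
have e20 : 0 < e / 2 by rewrite divr_gt0.
have v10 : 0 < `|v| + 1 by rewrite ltr_wpDl.
(* This gives [tau * |v| < e / 2]; the [+ 1] covers [v = 0]. *)
pose tau := e / 2 / (`|v| + 1).
have tau0 : 0 < tau by rewrite divr_gt0.
have [m mP] := @sparse_mean_large C archiC tau k tau0.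
have [f [finj fP]] : exists f : 'I_m.+1 -> C * X, injective (fun j => (f j).1) /\
    forall j, unimodular_eigenpair (f j).1 (f j).2 /\ `|v - (f j).2| < e / 2.
  have [s [ss us sP]] : exists s : seq (C * X), [/\ size s = m.+1,
      uniq (map fst s) & forall p, p \in s ->
      unimodular_eigenpair p.1 p.2 /\ `|v - p.2| < e / 2].
    (* The eigenvalues already listed are passed to [cond] as the finite set to avoid. *)
    elim: (m.+1) => [|n [s [ss us sP]]]; first by exists [::].
    have [l' [v' [lv' ls vv']]] := cond (ball v (e / 2)) (map fst s) (nbhsx_ballx _ _ e20).
    exists ((l', v') :: s); split => /=; first by rewrite ss.
      by rewrite ls us.
    move=> p; rewrite inE => /orP [/eqP ->|/sP//]; split => //=.
    by move: vv'; rewrite -ball_normE.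
  exists (fun j : 'I_m.+1 => nth (0, 0) s j); split=> [i j /= ij|j].
    apply/val_inj/eqP; rewrite /= -(nth_uniq 0 _ _ us) ?size_map ?ss//.
    by rewrite !(nth_map (0, 0)) ?ss// ij.
  by apply: sP; rewrite mem_nth// ss.
have m0 : 0 < m.+1%:R :> C by rewrite ltr0n.
have mean_lt (u : 'I_m.+1 -> C) : (forall j, u j < e / 2) ->
    m.+1%:R^-1 * \sum_j u j < e / 2.
  move=> ue; rewrite ltr_pdivrMl//.
  have -> : m.+1%:R * (e / 2) = \sum_(j < m.+1) (e / 2).
    by rewrite sumr_const card_ord mulr_natl.
  by apply: ltr_sum => //; apply/hasP; exists ord0; rewrite ?mem_index_enum.
pose y := m.+1%:R^-1 *: \sum_j (f j).2.
exists y.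
  have -> : v - y = m.+1%:R^-1 *: \sum_j (v - (f j).2).
    rewrite sumrB scalerBr sumr_const card_ord -[v *+ _]scaler_nat scalerA.
    by rewrite mulVf ?scale1r// gt_eqF.
  rewrite normrZ normfV normr_nat; apply: (@lt_trans _ _ (e / 2)); last first.
    by rewrite ltr_pdivrMr// mulr_natr mulr2n ltrDl.
  apply: le_lt_trans (mean_lt _ (fun j => (fP j).2)).
  by rewrite ler_pM2l ?invr_gt0//; exact: ler_norm_sum.
have := mP _ finj (fun j => (fP j).1.1); apply: sparse_sub => n /=.
apply: contra_not => qn; rewrite /norm_lt /= linear_iterZ linear_iter_sum.
(* After averaging, the first term is [v] times a small mean of powers, and the second stays below
   [e / 2] because the eigenvalues are unimodular. *)
have -> : \sum_j iter n T (f j).2 =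
    (\sum_j (f j).1 ^+ n) *: v + \sum_j (f j).1 ^+ n *: ((f j).2 - v).
  rewrite scaler_suml -big_split; apply: eq_bigr => j _ /=.
  by rewrite -scalerDr subrKC (iter_eigen _ _ _ (fP j).1.2).
rewrite scalerDr (splitr e); apply: le_lt_trans (ler_normD _ _) _; apply: ltrD.
  rewrite scalerA normrZ; apply: (@le_lt_trans _ _ (tau * `|v|)).
    by rewrite ler_wpM2r// ltW.
  by rewrite /tau mulrAC ltr_pdivrMr// ltr_pM2l// ltrDl.
rewrite normrZ normfV normr_nat.
apply: le_lt_trans (mean_lt _ (fun j => (fP j).2)).
rewrite ler_pM2l ?invr_gt0//; apply: le_trans (ler_norm_sum _ _ _) _.
apply: ler_sum => j _; rewrite normrZ normrX (fP j).1.1 expr1n mul1r.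
by rewrite distrC.
Qed.

(** Each term keeps its norm along the orbit. The bound prevents the orbit of [x] from cancelling a
    large perturbation. *)
Lemma span_eigenvectors_bounded_orbit (S : set X) (x : X) :
  (forall v, S v -> exists l, unimodular_eigenpair l v) -> in_span S x ->
  exists B : C, 0 <= B /\ forall n, `|iter n T x| <= B.
Proof.
move=> SE [m [v [c [Sv ->]]]]; exists (\sum_i `|c i *: v i|); split.
  by apply: sumr_ge0.
move=> n; rewrite linear_iter_sum; apply: le_trans (ler_norm_sum _ _ _) _.
apply: ler_sum => i _; have [l [l1 Tv]] := SE _ (Sv i).
by rewrite linear_iterZ (iter_eigen _ _ _ Tv) !normrZ normrX l1 expr1n mul1r.
Qed.

(* Adding [M *: (v - v')], with [v'] so close to [v] that this is a small
   perturbation, makes the orbit large outside the return times of [l' / l]. *)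
Lemma bounded_orbit_sparsely_small (x v : X) (l B : C) (O : set X) k :
  0 <= B -> (forall n, `|iter n T x| <= B) -> nbhs x O -> v != 0 ->
  unimodular_eigenpair l v ->
  (forall (O : set X) (F : seq C), nbhs v O ->
    exists l' v', [/\ unimodular_eigenpair l' v', l' \notin F & O v']) ->
  exists2 y, O y & frequent k [set i | norm_gt k%:R (iter i T y)].
Proof.
move=> B0 xB /nbhs_ballP [e /= e0 eO] v0 [l1 Tv] cond.
have nv0 : 0 < `|v| by rewrite normr_gt0.
(* [L] is the sparsity that [sparse_frequent] asks for, [d] the distance given by [sparse_returns],
   [M] solves [M * d * |v| = k + B + 1], and two errors [r] add up to [|v| / (4 * L)]. *)
pose L := k.+2; pose d : C := (8 * L)%:R^-1.
have d0 : 0 < d by rewrite invr_gt0 ltr0n muln_gt0.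
pose M := (k%:R + B + 1) / (d * `|v|).
have M0 : 0 < M by rewrite divr_gt0 ?mulr_gt0// ltr_wpDl// addr_ge0.
pose r := `|v| * (4 * L)%:R^-1 / 2.
have r0 : 0 < r by rewrite !mulr_gt0 ?invr_gt0 ?ltr0n.
have [l' [v' [[l1' Tv'] ll' [[vr ve] [v1 Tvr]]]]] :
    exists l' v', [/\ unimodular_eigenpair l' v', l' \notin [:: l] &
     ((ball v r `&` ball v (e / M)) `&` (ball v M^-1 `&` T @^-1` ball (T v) r)) v'].
  have eM0 : 0 < e / M by rewrite divr_gt0.
  have iM0 : 0 < M^-1 by rewrite invr_gt0.
  apply: cond; apply: filterI; apply: filterI.
  - exact: nbhsx_ballx r0.
  - exact: nbhsx_ballx eM0.
  - exact: nbhsx_ballx iM0.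
  - by apply: cT; exact: nbhsx_ballx r0.
move: vr ve v1 Tvr; rewrite /= -!ball_normE /= => vr ve v1 Tvr.
have l0 : l != 0 by rewrite -normr_gt0 l1.
have w1 : `|l' / l| = 1 by rewrite normrM normfV l1 l1' invr1 mulr1.
have wn1 : l' / l != 1.
  by apply: contra ll' => /eqP h; rewrite inE -(divfK l0 l') h mul1r.
(* The eigenvalues are close because [(l - l') *: v = (T v - T v') - l' *: (v - v')]; this is where
   closeness of [T v'] to [T v] enters. *)
have wL : `|1 - l' / l| <= (4 * L)%:R^-1.
  have -> : `|1 - l' / l| = `|l - l'|.
    by rewrite -[LHS]mul1r -{1}l1 -normrM mulrBr mulr1 mulrCA divff// mulr1.
  rewrite -(ler_pM2r nv0) -normrZ.
  have -> : (l - l') *: v = (T v - T v') + - (l' *: (v - v')).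
    by rewrite Tv Tv' scalerBl scalerBr opprB addrA subrK.
  apply: le_trans (ler_normD _ _) _; rewrite normrN normrZ l1' mul1r.
  apply: le_trans (ltW (ltrD Tvr vr)) _.
  by rewrite /r -splitr mulrC.
exists (x + M *: (v - v')).
  apply: eO; rewrite -ball_normE /= opprD addNKr normrN normrZ gtr0_norm//.
  by rewrite -ltr_pdivlMl// mulrC.
apply: sparse_frequent.
apply: sparse_sub (@sparse_returns C archiC _ L _ w1 wn1 wL) => // n /=.
apply: contra_not => far; rewrite /norm_gt /= linear_iterD linear_iterZ.
(* Off the return times the first term has norm at least [d * |v|], while the second is no larger
   than [v - v']. *)
have -> : iter n T (v - v') = (l ^+ n - l' ^+ n) *: v + l' ^+ n *: (v - v').
  have iN : iter n T (- v') = - iter n T v'.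
    by rewrite -scaleN1r linear_iterZ scaleN1r.
  rewrite linear_iterD iN.
  rewrite (iter_eigen _ _ _ Tv) (iter_eigen _ _ _ Tv').
  by rewrite scalerBl scalerBr addrA subrK.
rewrite scalerDr.
set a := M *: _; set b := M *: _; set z := iter n T x.
have bl : `|b| < 1.
  rewrite /b normrZ (gtr0_norm M0) normrZ normrX l1' expr1n mul1r.
  by rewrite -ltr_pdivlMl// mulr1.
have al : k%:R + B + 1 <= `|a|.
  rewrite /a normrZ (gtr0_norm M0) normrZ.
  have -> : l ^+ n - l' ^+ n = l ^+ n * (1 - (l' / l) ^+ n).
    by rewrite mulrBr mulr1 expr_div_n mulrCA divff ?mulr1// expf_neq0.
  rewrite normrM normrX l1 expr1n mul1r.
  rewrite (_ : k%:R + B + 1 = M * (d * `|v|)); last first.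
    by rewrite /M divfK// mulf_neq0 ?gt_eqF.
  by rewrite ler_pM2l// ler_pM2r.
have atri : `|a| <= `|z + (a + b)| + (`|z| + `|b|).
  rewrite {1}(_ : a = (z + (a + b)) - (z + b)); last first.
    by rewrite opprD addrACA subrr add0r addrK.
  by apply: le_trans (ler_normB _ _) _; rewrite lerD2l ler_normD.
rewrite -(ltrD2r (B + 1)); apply: (@lt_le_trans _ _ (`|z + (a + b)| + (B + 1))) => //.
rewrite addrA; apply: le_lt_trans al _; apply: le_lt_trans atri _.
by rewrite ltrD2l; exact: ler_ltD (xB n) bl.
Qed.

End eigenvectors.

(** * Conclusion over the real and complex fields *)

Lemma archimedean_complex (R : realType) (a : R[i]) :
  0 <= a -> exists n : nat, a < n%:R.
Proof.
(* A nonnegative element of [R[i]] is real, which reduces the claim to [R]. *)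
move=> a0; have aE : a = (complex.Re a)%:C%C by apply/esym/RRe_real; exact: ger0_real.
have ra : 0 <= complex.Re a by rewrite -lecR -aE.
exists (Num.truncn (complex.Re a)).+1; rewrite aE -[_%:R](rmorph_nat (real_complex R)) ltcR.
exact: truncnS_gt.
Qed.

Lemma archimedean_inv (K : numFieldType) :
  (forall a : K, 0 <= a -> exists n : nat, a < n%:R) ->
  forall e : K, 0 < e -> exists n : nat, n.+1%:R^-1 < e.
Proof.
move=> archiK e e0; have [|n ne] := archiK e^-1; first by rewrite invr_ge0 ltW.
exists n; rewrite -[X in _ < X]invrK ltf_pV2 ?posrE ?invr_gt0 ?ltr0n//.
by apply: lt_trans ne _; rewrite ltr_nat.
Qed.

Lemma infinite_dimensional_neq0 (K : numFieldType) (X : lmodType K) :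
  infinite_dimensional X -> exists x : X, x != 0.
Proof.
move=> /(_ 0%N (fun=> 0)) [x xspan]; exists x; apply/eqP => x0; apply: xspan.
exists 0%N, (fun=> 0), (fun=> 0); split=> [[]//|].
by rewrite big_ord0.
Qed.

Lemma ergodic_distr_irregular (R : realType) (K : numFieldType)
    (X : normedModType K) (T : {linear X -> X}) (mu : probability (Borel X) R) :
  (forall a : K, 0 <= a -> exists n : nat, a < n%:R) ->
  continuous T -> infinite_dimensional X -> ergodic T mu -> full_support mu ->
  comeager [set x : X | distr_irregular R T x].
Proof.
move=> archiK cT infX ergT suppT.
have X0 := @infinite_dimensional_neq0 _ _ infX.
apply: distr_irregular_comeager => //; first exact: archimedean_inv.
- by move=> k; exact: ergodic_dense_norm_lt ergT suppT archiK k.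
- by move=> k; exact: ergodic_dense_norm_gt ergT suppT archiK X0 k.
Qed.

Lemma perfectly_spanning_distr_irregular (R : realType)
    (X : normedModType R[i]) (T : {linear X -> X}) :
  continuous T -> separable X -> infinite_dimensional X ->
  perfectly_spanning_unimodular T ->
  comeager [set x : X | distr_irregular R T x].
Proof.
move=> cT sepX infX spanT.
have archiC := @archimedean_complex R.
have [D cD Dcond] := @eigenpair_condensation _ X T archiC sepX.
(* Perfect spanning is used with the set [D] of eigenvalues where condensation may fail, so the span
   of [S] is dense. *)
pose S := [set x : X | exists l : R[i], `|l| = 1 /\ ~ D l /\ T x = l *: x].
have near_span (O : set X) : open O -> O !=set0 -> exists2 x, O x & in_span S x.
  move=> oO [x Ox]; have : closure (in_span S) x by rewrite /S spanT.
  move=> /(_ O (open_nbhs_nbhs (conj oO Ox))) [y [Sy Oy]].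
  by exists y.
apply: distr_irregular_comeager => //; first exact: archimedean_inv.
- move=> k O O0 oO; have [x Ox [n [v [c [Sv xE]]]]] := near_span O oO O0.
  have Gx : sparsely_large_approx _ _ T x.
    (* The coefficient is absorbed: [c i *: v i] satisfies the same eigenvalue equation as [v i]. *)
    rewrite xE; apply: sparsely_large_approx_sum => i.
    have [l [l1 [Dl Tv]]] := Sv i.
    apply: (@eigenvector_sparsely_large _ _ _ archiC).
    apply: (Dcond l _ _ Dl); split=> //.
    by rewrite linearZ /= Tv !scalerA mulrC.
  have /nbhs_ballP [e /= e0 eO] : nbhs x O by apply: open_nbhs_nbhs.
  have [n0 n0e] := @archimedean_inv _ archiC e e0.
  pose e' : R[i] := (maxn n0 k).+1%:R^-1.
  have e'le m : (m <= maxn n0 k)%N -> e' <= m.+1%:R^-1.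
    by move=> mm; rewrite lef_pV2 ?posrE ?ltr0n// ler_nat ltnS.
  have [|y xy ky] := Gx e' k.+2; first by rewrite invr_gt0 ltr0n.
  exists y; split.
    apply: eO; rewrite -ball_normE /=; apply: lt_trans n0e.
    by apply: lt_le_trans xy (e'le _ _); exact: leq_maxl.
  apply: sparse_frequent; apply: sparse_sub ky => i /=; apply: contra_not.
  by move=> h; apply: lt_le_trans h (e'le _ _); exact: leq_maxr.
- move=> k O O0 oO; have [x Ox Sx] := near_span O oO O0.
  have [B [B0 xB]] := @span_eigenvectors_bounded_orbit _ X T S x
     (fun v '(ex_intro l (conj l1 (conj _ Tv))) => ex_intro _ l (conj l1 Tv)) Sx.
  (* The zero vector may lie in [S]; were there no other, the span would be [{0}] and miss the open
     set of nonzero vectors. *)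
  have [v v0 [l [l1 [Dl Tv]]]] : exists2 v, v != 0 & S v.
    have [x0 x00] := @infinite_dimensional_neq0 _ _ infX.
    have cl0 := @closed_set1_normed _ X 0.
    have [|z z0 [n [v [c [Sv zE]]]]] := near_span _ (closed_openC cl0).
      by exists x0; exact/eqP.
    apply: contrapT => nS; apply: z0; rewrite /= zE big1// => i _.
    have [->|vi0] := eqVneq (v i) 0; first by rewrite scaler0.
    by case: nS; exists (v i).
  have lv : unimodular_eigenpair _ X T l v by split.
  have [y Oy ky] := @bounded_orbit_sparsely_small _ X T archiC cT x v l B O k B0 xB
    (open_nbhs_nbhs (conj oO Ox)) v0 lv (Dcond l v lv Dl).
  by exists y.
Qed.

Theorem theorem1p5 (R : realType) :
  (* real Banach spaces *)
  (forall (X : completeNormedModType R) (T : {linear X -> X}),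
     continuous T -> separable X -> infinite_dimensional X ->
     (exists mu : probability (Borel X) R, ergodic T mu /\ full_support mu) ->
     comeager [set x : X | distr_irregular R T x]) /\
  (* complex Banach spaces *)
  (forall (X : completeNormedModType R[i]) (T : {linear X -> X}),
     continuous T -> separable X -> infinite_dimensional X ->
     (exists mu : probability (Borel X) R, ergodic T mu /\ full_support mu) ->
     comeager [set x : X | distr_irregular R T x]) /\
  (* in particular: perfectly spanning unimodular eigenvectors *)
  (forall (X : completeNormedModType R[i]) (T : {linear X -> X}),
     continuous T -> separable X -> infinite_dimensional X ->
     perfectly_spanning_unimodular T ->
     comeager [set x : X | distr_irregular R T x]).
Proof.
split; [|split] => X T cT sepX infX.
- move=> [mu [ergT suppT]]; apply: ergodic_distr_irregular ergT suppT => // a _.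
  by exists (Num.truncn a).+1; exact: truncnS_gt.
- move=> [mu [ergT suppT]]; apply: ergodic_distr_irregular ergT suppT => //.
  exact: archimedean_complex.
- exact: perfectly_spanning_distr_irregular.
Qed.
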